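(* Let $(\alpha_n)$ be a sequence of positive numbers converging to zero and let $\mathcal{Z}$ be an open and bounded subset of $\mathbb{R}^d$. Let $C_{\mathrm{H}}, C_{\nabla}, L>0$ and $k\in(0,1]$ be constants. Assume that $\mathcal{H}$ is a uniformly bounded set of differentiable functions $h:\mathrm{Conv}(\mathcal{Z})\to\mathbb{R}$ such that, for every $h\in\mathcal{H}$, the gradient $\nabla_z h$ is $(C_{\mathrm{H}},k)$-Hölder continuous, $\mathbb{E}_{\mathrm{data}}(\|\nabla_z h\|_* )\ge C_{\nabla}$, and $\mathrm{Lip}(h)\le L$. For $p\in(1+k,\infty)$, let $\hat h^{\mathrm{prop}}_{\alpha_n,p}$ denote a minimizer over $h\in\mathcal{H}$ of $$R^{\mathrm{prop}}_{\alpha_n,p}(\mathbb{P}_n,h)=R(\mathbb{P}_n,h)+\alpha_n\|\nabla_z h\|_{\mathbb{P}_n,p^*}.$$ Then $$\mathcal{E}(\hat h^{\mathrm{prop}}_{\alpha_n,p})=O_p\left(\mathfrak{R}_n(\mathcal{H})\vee n^{-1/2}\vee\alpha_n\vee\log(n)\,\alpha_n^{1+k}\right).$$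
   Context: $\|\cdot\|$ is a norm on $\mathbb{R}^d\supseteq\mathcal{Z}$ and $\|\cdot\|_*$ its dual norm; $a\vee b=\max(a,b)$. $\mathbb{P}_{\mathrm{data}}$ is the true data distribution, a Borel probability measure on $\mathcal{Z}$; $z_1,\dots,z_n$ are i.i.d. samples from $\mathbb{P}_{\mathrm{data}}$, and $\mathbb{P}_n=\frac1n\sum_{i=1}^n\delta_{z_i}$. $\mathbb{E}_{\mathrm{data}}$ denotes expectation under $\mathbb{P}_{\mathrm{data}}$ (for functions of several samples, under i.i.d. draws from it). $R(\mathbb{Q},h)=\int h\,d\mathbb{Q}$. The excess risk of $g\in\mathcal{H}$ is $\mathcal{E}(g)=R(\mathbb{P}_{\mathrm{data}},g)-\inf_{h\in\mathcal{H}}R(\mathbb{P}_{\mathrm{data}},h)$. The Rademacher complexity is $\mathfrak{R}_n(\mathcal{H})=\mathbb{E}_{\mathrm{data}}\mathbb{E}_\sigma\big(\frac1n\sup_{h\in\mathcal{H}}|\sum_{i=1}^n\sigma_i h(Z_i)|\big)$, where $Z_1,\dots,Z_n$ are i.i.d. from $\mathbb{P}_{\mathrm{data}}$ and $\sigma_1,\dots,\sigma_n$ are independent random variables taking values $\pm1$ with probability $1/2$ each. $\mathrm{Conv}(\mathcal{Z})$ is the convex hull of $\mathcal{Z}$. $\mathrm{Lip}(h)$ is the smallest Lipschitz constant of $h$ with respect to $\|\cdot\|$. A function $g$ from a set $D\subseteq\mathbb{R}^d$ to $\mathbb{R}^d$ is $(C_{\mathrm{H}},k)$-Hölder continuous if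 $\|g(z)-g(\tilde z)\|_*\le C_{\mathrm{H}}\|z-\tilde z\|^k$ for all $z,\tilde z\in D$. For $r\in[1,\infty)$ and a probability measure $\mathbb{Q}$, $\|g\|_{\mathbb{Q},r}=(\int\|g(z)\|_*^r\,d\mathbb{Q}(z))^{1/r}$. $p^*=(1-1/p)^{-1}$. For a random sequence $(B_n)$ and positive constants $(a_n)$, $B_n=O_p(a_n)$ means: for every $\varepsilon>0$ there exist constants $C,n_0$ such that $P(|B_n|>Ca_n)<\varepsilon$ for all $n\ge n_0$. *)

(* Defs.v *)
From HB Require Import structures.
From mathcomp Require Import all_boot all_order all_algebra.
From mathcomp Require Import all_classical all_reals all_analysis.
Set Implicit Arguments.
Unset Strict Implicit.
Unset Printing Implicit Defensive.
Import Order.TTheory GRing.Theory Num.Theory.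
Import numFieldNormedType.Exports.
Local Open Scope classical_set_scope.
Local Open Scope ring_scope.

(* The row vectors with their Borel sigma-algebra.  Functions on (subsets of)
   R^d are total functions on 'rV[R]_d whose values off the domain are
   irrelevant; gradients only depend on the values on an open domain. *)
Notation borel_rV R d := (g_sigma_algebraType (@open 'rV[R]_d)).

Definition is_norm (R : realType) (d : nat) (N : 'rV[R]_d -> R) : Prop :=
  [/\ forall x y, N (x + y) <= N x + N y,
      forall (a : R) x, N (a *: x) = `|a| * N x
    & forall x, N x = 0 -> x = 0].

Definition dual_norm (R : realType) (d : nat) (N : 'rV[R]_d -> R)
    (y : 'rV[R]_d) : R :=
  sup [set \sum_(i < d) y ord0 i * x ord0 i | x in [set x | N x <= 1]].

Definition Conv (R : realType) (d : nat) (Z : set 'rV[R]_d) : set 'rV[R]_d :=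
  smallest (@convex_set R 'rV[R]_d) Z.

Definition grad (R : realType) (d : nat) (h : 'rV[R]_d -> R) (x : 'rV[R]_d) :
    'rV[R]_d :=
  \row_(j < d) 'D_(delta_mx ord0 j) h x.

(* +oo when h has no Lipschitz constant on D. *)
Definition Lip (R : realType) (d : nat) (N : 'rV[R]_d -> R)
    (D : set 'rV[R]_d) (h : 'rV[R]_d -> R) : \bar R :=
  ereal_inf [set l%:E | l in [set l : R | 0 <= l /\
    forall x y, D x -> D y -> `|h x - h y| <= l * N (x - y)]].

Definition hoelder_continuous (R : realType) (d : nat) (N : 'rV[R]_d -> R)
    (D : set 'rV[R]_d) (CH k : R) (g : 'rV[R]_d -> 'rV[R]_d) : Prop :=
  forall x y, D x -> D y -> dual_norm N (g x - g y) <= CH * N (x - y) `^ k.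

Definition uniformly_bounded (R : realType) (d : nat) (D : set 'rV[R]_d)
    (H : set ('rV[R]_d -> R)) : Prop :=
  exists M : R, forall h, H h -> forall x, D x -> `|h x| <= M.

Section sampling.
Context (R : realType) (d : nat).
Implicit Types (N : 'rV[R]_d -> R) (Z : set 'rV[R]_d)
  (H : set ('rV[R]_d -> R)) (Q : {measure set (borel_rV R d) -> \bar R}).

Definition risk Z Q (h : 'rV[R]_d -> R) : R := \int[Q]_(x in Z) h x.

Definition excess_risk Z Q H (g : 'rV[R]_d -> R) : R :=
  risk Z Q g - inf [set risk Z Q h | h in H].

Definition Lr_norm N Z Q (r : R) (g : 'rV[R]_d -> 'rV[R]_d) : R :=
  (\int[Q]_(x in Z) (dual_norm N (g x) `^ r)) `^ r^-1.

Definition prop_risk N Z Q (alpha p : R) (h : 'rV[R]_d -> R) : R :=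
  risk Z Q h + alpha * Lr_norm N Z Q (1 - p^-1)^-1 (grad h).

Definition is_minimizer H (F : ('rV[R]_d -> R) -> R) (g : 'rV[R]_d -> R) :
    Prop :=
  H g /\ forall h, H h -> F g <= F h.

Definition empirical (n : nat) (x : nat -> borel_rV R d) :
    {measure set (borel_rV R d) -> \bar R} :=
  mscale (n%:R^-1)%:nng (msum (fun i => \d_(x i)) n).

Context (dO : measure_display) (Omega : measurableType dO).
Implicit Type P : probability Omega R.

Definition mutually_independent P
    (z : nat -> {mfun Omega >-> borel_rV R d}) : Prop :=
  forall (J : seq nat) (A : nat -> set (borel_rV R d)),
    uniq J -> (forall j, measurable (A j)) ->
    P (\bigcap_(j in [set` J]) (z j @^-1` A j)) =
    (\prod_(j <- J) P (z j @^-1` A j))%E.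

Definition iid P (Q : probability (borel_rV R d) R)
    (z : nat -> {mfun Omega >-> borel_rV R d}) : Prop :=
  mutually_independent P z /\
  forall i A, measurable A -> distribution P (z i) A = Q A.

(* For z iid from Q, this is the Rademacher complexity of H under Q.
   Independent uniform signs sigma_1, ..., sigma_n are the coordinates of a
   uniformly distributed vector of {-1, 1}^n, whence the average over the 2 ^ n
   sign vectors.  The value depends on (P, z) only through the law of the first
   n terms of z. *)
Definition rademacher P (z : nat -> {mfun Omega >-> borel_rV R d}) H
    (n : nat) : R :=
  \int[P]_w ((2 ^+ n)^-1 * \sum_(s : {ffun 'I_n -> bool})
    (n%:R^-1 * sup [set `|\sum_(i < n) (-1) ^+ s i * h (z i w)| | h in H])).

(* B n is not assumed measurable: the event is required to be contained in a
   measurable set of probability less than eps, i.e. its outer probability is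
   less than eps. *)
Definition big_Op P (B : nat -> Omega -> R) (a : nat -> R) : Prop :=
  forall eps : R, 0 < eps -> exists (C : R) (n0 : nat), forall n, (n0 <= n)%N ->
    exists A : set Omega, [/\ measurable A,
      [set w | C * a n < `|B n w|] `<=` A & (P A < eps%:E)%E].

End sampling.

(* Main.v *)
(* Minimality of the penalized risk and 0 <= ||grad h||_{P_n,p*} <= L + 1 bound
   the excess risk by 2 sup_h |R(P_n, h) - R(P_data, h)| + (L + 1) alpha_n, so
   what is left is a uniform law of large numbers, obtained in expectation by
   symmetrization and turned into a tail bound by Markov's inequality.  The
   functions of H are equi-Lipschitz on a bounded set: up to an error of order
   n^(-1/2), uniform over H, the sample points may be replaced by the centres of
   the cells of a finite partition, and symmetrization becomes an inequality
   between finite sums. *)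
Require Import Defs.
From HB Require Import structures.
From mathcomp Require Import all_boot all_order all_algebra.
From mathcomp Require Import all_classical all_reals all_analysis.
From mathcomp Require Import measurable_realfun lra.
Import Order.TTheory GRing.Theory Num.Theory.
Import numFieldNormedType.Exports.
Local Open Scope classical_set_scope.
Local Open Scope ring_scope.

Set Implicit Arguments.
Unset Strict Implicit.
Unset Printing Implicit Defensive.

(** * Symmetrization on a finite sample space *)

Section sup_abs.
Variables (R : realType) (T : Type) (H : set T).
Implicit Types F G : T -> R.

Definition sup_abs F : R := sup [set `|F h| | h in H].

Lemma sup_abs_ub F (M : R) h : (forall g, H g -> `|F g| <= M) -> H h ->
  `|F h| <= sup_abs F.
Proof.
move=> FM Hh; apply: ub_le_sup; last by exists h.
by exists M => _ [g Hg <-]; exact: FM.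
Qed.

Lemma sup_abs_le F (M : R) : H !=set0 -> (forall h, H h -> `|F h| <= M) ->
  sup_abs F <= M.
Proof.
move=> [h Hh] FM; apply: ge_sup; first by exists `|F h|, h.
by move=> _ [g Hg <-]; exact: FM.
Qed.

(** No bound on the family enters: when it is empty or unbounded, the real [sup] takes its default
    value 0. *)
Lemma sup_abs_ge0 F : 0 <= sup_abs F.
Proof.
rewrite /sup_abs.
have [[r [h Hh rE]]|nE] := pselect ([set `|F h| | h in H] !=set0).
  have [ub|nub] := pselect (has_ubound [set `|F h| | h in H]).
    by apply: (le_trans (normr_ge0 (F h))); apply: ub_le_sup => //; exists h.
  by rewrite sup_out// => -[].
by rewrite sup_out// => -[].
Qed.

Lemma eq_sup_abs F G : (forall h, H h -> `|F h| = `|G h|) ->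
  sup_abs F = sup_abs G.
Proof. by move=> FG; congr sup; apply: eq_imagel. Qed.

End sup_abs.

Section finite_symmetrization.
Variables (R : realType) (K : finType) (n : nat) (q : K -> R).
Hypotheses (q0 : forall k, 0 <= q k) (q1 : \sum_k q k = 1).
Variables (T : Type) (H : set T) (F : T -> K -> R) (M : R).
Hypotheses (H0 : H !=set0) (FM : forall h, H h -> forall k, `|F h k| <= M).

Local Notation smp := {ffun 'I_n -> K}.
Implicit Types (c : smp) (s : {ffun 'I_n -> bool}).

(** The probability of the sample [c] under [n] independent draws from [q]. *)
Let wt c := \prod_i q (c i).

Let wt_ge0 c : 0 <= wt c.
Proof. exact: prodr_ge0. Qed.

Let sum_wt : \sum_c wt c = 1.
Proof. by rewrite /wt -(bigA_distr_bigA (fun=> q)) big1. Qed.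

(** The [j]-th marginal of the product law is [q]: with [f] inserted into the [j]-th factor only,
    the sum of products becomes a product of sums whose other factors are all 1. *)
Let sum_wt_proj (j : 'I_n) (f : K -> R) :
  \sum_c wt c * f (c j) = \sum_k q k * f k.
Proof.
pose g (i : 'I_n) k := q k * (if i == j then f k else 1).
transitivity (\sum_(c : smp) \prod_i g i (c i)).
  apply: eq_bigr => c _; rewrite big_split/=; congr (_ * _).
  by rewrite -big_mkcond/= big_pred1_eq.
rewrite -(bigA_distr_bigA g) (bigD1 j)//= [X in _ * X]big1 ?mulr1.
  by apply: eq_bigr => k _; rewrite /g eqxx.
move=> i /negbTE ij; rewrite /g ij -[RHS]q1; apply: eq_bigr => k _.
by rewrite mulr1.
Qed.

Let sum_bnd s c h : H h -> `|\sum_i (-1) ^+ s i * F h (c i)| <= n%:R * M.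
Proof.
move=> Hh; apply: le_trans (ler_norm_sum _ _ _) _.
rewrite -[X in X%:R * _]card_ord -sumr_const mulr_suml; apply: ler_sum => i _.
by rewrite normrM normrX normrN1 expr1n !mul1r; exact: FM.
Qed.

Let dif s c c' h := \sum_i (-1) ^+ s i * (F h (c i) - F h (c' i)).

Let dif_split s c c' h : dif s c c' h =
  \sum_i (-1) ^+ s i * F h (c i) - \sum_i (-1) ^+ s i * F h (c' i).
Proof. by rewrite -sumrB; apply: eq_bigr => i _; rewrite mulrBr. Qed.

Let dif_bnd s c c' h : H h -> `|dif s c c' h| <= n%:R * M + n%:R * M.
Proof.
move=> Hh; rewrite dif_split; apply: le_trans (ler_normB _ _) _.
by apply: lerD; exact: sum_bnd.
Qed.

Let swp s (cc : smp * smp) : smp * smp :=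
  ([ffun i => if s i then cc.2 i else cc.1 i],
   [ffun i => if s i then cc.1 i else cc.2 i]).

Let swpK s : involutive (swp s).
Proof.
move=> [c c']; apply: injective_projections; apply/ffunP => i;
  by rewrite /swp/= !ffunE; case: (s i).
Qed.

Let wt2 (cc : smp * smp) := wt cc.1 * wt cc.2.

(* Exchanging [c i] and [c' i] where [s i] holds preserves the law of the pair
   of samples and multiplies the i-th difference by the sign. *)
Let sum_dif_sign s : \sum_cc wt2 cc * sup_abs H (dif [ffun=> false] cc.1 cc.2) =
  \sum_cc wt2 cc * sup_abs H (dif s cc.1 cc.2).
Proof.
rewrite (reindex_inj (can_inj (swpK s)))/=; apply: eq_bigr => -[c c'] _ /=.
congr (_ * _).
  rewrite /wt2 /wt/= -!big_split/=; apply: eq_bigr => i _; rewrite !ffunE.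
  by case: ifP => // _; rewrite mulrC.
apply: eq_sup_abs => h _; congr (`| _ |); apply: eq_bigr => i _; rewrite !ffunE.
by case: (s i); rewrite /= ?expr0 ?expr1 ?mul1r// mulN1r opprB.
Qed.

(** Ghost sample argument: the mean is an average over an independent copy [c'], random signs may
    then be inserted by exchanging coordinates, and the two halves of the difference have the same
    law, whence the factor 2. *)
Lemma finite_symmetrization :
  \sum_(c : smp) (\prod_i q (c i)) *
     sup_abs H (fun h => \sum_i (F h (c i) - \sum_k q k * F h k)) <=
  2 * \sum_(c : smp) (\prod_i q (c i)) * ((2 ^+ n)^-1 *
     \sum_(s : {ffun 'I_n -> bool})
       sup_abs H (fun h => \sum_i (-1) ^+ s i * F h (c i))).
Proof.
pose D s := \sum_cc wt2 cc * sup_abs H (dif s cc.1 cc.2).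
(* Jensen's inequality: the average over [c'] leaves the absolute value and then the supremum. *)
have ghost : \sum_c wt c * sup_abs H
    (fun h => \sum_i (F h (c i) - \sum_k q k * F h k)) <= D [ffun=> false].
  rewrite /D -(pair_bigA _ (fun c c' => wt2 (c, c') *
    sup_abs H (dif [ffun=> false] c c')))/=.
  apply: ler_sum => c _; rewrite /wt2/=.
  under [leRHS]eq_bigr do rewrite -mulrA.
  rewrite -mulr_sumr; apply: ler_wpM2l => //.
  apply: sup_abs_le => // h Hh.
  have -> : \sum_i (F h (c i) - \sum_k q k * F h k) =
      \sum_c' wt c' * dif [ffun=> false] c c' h.
    under [RHS]eq_bigr do rewrite mulr_sumr.
    rewrite exchange_big/=; apply: eq_bigr => i _.
    rewrite -(sum_wt_proj i) -[in LHS](mul1r (F h (c i))) -sum_wt mulr_suml.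
    by rewrite -sumrB; apply: eq_bigr => c' _; rewrite ffunE mul1r mulrBr.
  apply: le_trans (ler_norm_sum _ _ _) _; apply: ler_sum => c' _.
  rewrite normrM (ger0_norm (wt_ge0 c')) ler_wpM2l//.
  apply: sup_abs_ub Hh; exact: dif_bnd.
have Dle s : D s <= 2 * \sum_c wt c *
    sup_abs H (fun h => \sum_i (-1) ^+ s i * F h (c i)).
  pose S c := sup_abs H (fun h => \sum_i (-1) ^+ s i * F h (c i)).
  rewrite -[leRHS]/(2 * (\sum_c wt c * S c)).
  have -> : 2 * (\sum_c wt c * S c) = \sum_cc wt2 cc * (S cc.1 + S cc.2).
    rewrite -(pair_bigA _ (fun c c' => wt2 (c, c') * (S c + S c')))/=.
    rewrite mulr_natl mulr2n.
    under [RHS]eq_bigr => c _ do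
      (under eq_bigr do rewrite mulrDr; rewrite big_split/=).
    rewrite big_split/=; congr (_ + _).
      apply: eq_bigr => c _; rewrite -mulr_suml; congr (_ * _).
      by rewrite /wt2/= -mulr_sumr sum_wt mulr1.
    rewrite exchange_big/=; apply: eq_bigr => c _; rewrite -mulr_suml.
    by rewrite /wt2/= -mulr_suml sum_wt mul1r.
  apply: ler_sum => -[c c'] _; rewrite ler_wpM2l ?mulr_ge0//=.
  apply: sup_abs_le => // h Hh; rewrite dif_split.
  apply: le_trans (ler_normB _ _) _.
  by apply: lerD; apply: sup_abs_ub Hh => g Hg; exact: sum_bnd.
apply: (le_trans ghost).
have n2 : (2 ^+ n : R) != 0 by rewrite expf_neq0.
rewrite -[leLHS](mulKf n2).
(* All [2 ^+ n] values [D s] are equal, so each is their average over the signs. *)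
have -> : 2 ^+ n * D [ffun=> false] = \sum_s D s.
  rewrite (eq_bigr (fun=> D [ffun=> false])); last first.
  by move=> s _; exact/esym/sum_dif_sign.
  by rewrite sumr_const card_ffun card_bool card_ord -natrX mulr_natl.
apply: le_trans.
  apply: ler_wpM2l; first by rewrite invr_ge0 exprn_ge0.
  by apply: ler_sum => s _; exact: Dle.
rewrite le_eqVlt; apply/orP; left; apply/eqP.
rewrite -mulr_sumr mulrCA; congr (_ * _); rewrite exchange_big/= mulr_sumr.
by apply: eq_bigr => c _; rewrite -mulr_sumr mulrCA.
Qed.

End finite_symmetrization.

(** * Finite partitions and lower integrals *)

(** The integral of an arbitrary nonnegative function is a supremum over the simple functions below
    it, and those below [f] are below [g]. *)
Lemma ge0_le_lower_integral d (T : measurableType d) (R : realType)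
    (mu : {measure set T -> \bar R}) (D : set T) (f g : T -> \bar R) :
  (forall x, D x -> 0 <= f x)%E -> (forall x, D x -> f x <= g x)%E ->
  (\int[mu]_(x in D) f x <= \int[mu]_(x in D) g x)%E.
Proof.
move=> f0 fg; rewrite !ge0_integralE//; last first.
  by move=> x Dx; apply: le_trans (fg _ Dx); exact: f0.
apply: le_ereal_sup => _ [h /= hf <-]; exists h => //= x.
apply: le_trans (hf x) _; rewrite /patch; case: ifPn => // /set_mem; exact: fg.
Qed.

Section totally_bounded.
Variables (R : realType) (d : nat).
Local Notation V := 'rV[R]_d.

(** A closed ball containing [Z] is compact, so finitely many balls of radius [e] cover it. *)
Lemma bounded_finite_net (Z : set V) (e : R) : bounded_set Z -> 0 < e ->
  exists s : seq V, forall x, Z x -> exists2 c, c \in s & `|c - x| < e.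
Proof.
move=> Zb e0; have [M [_ ZM]] := Zb.
pose B := closed_ball (0 : V) (`|M| + 1).
have M0 : 0 < `|M| + 1 by rewrite ltr_wpDl.
have cB : compact B.
  apply: bounded_closed_compact; last exact: closed_ball_closed.
  exists (`|M| + 1); split; first exact: num_real.
  move=> r /ltW Mr x; rewrite /B closed_ballE// /closed_ball_/= sub0r normrN.
  move=> /le_trans.
  exact.
have ZB : Z `<=` B.
  move=> x Zx; rewrite /B closed_ballE// /closed_ball_/= sub0r normrN.
  by apply: ZM Zx; rewrite (le_lt_trans (ler_norm _))// ltrDl.
move: cB; rewrite compact_cover => /(_ _ setT (fun c : V => ball c e)).
case=> [c _|x _|D _ BD]; first exact: ball_open.
  by exists x => //; exact: ballxx.
exists (finmap.enum_fset D) => x /ZB /BD [c /= cD].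
by rewrite -ball_normE/= => xc; exists c.
Qed.

(* The cells are the balls of a finite net, made disjoint. *)
Lemma bounded_finite_partition (Z : set V) (e : R) :
  Z !=set0 -> bounded_set Z -> 0 < e ->
  exists (m : nat) (pi : borel_rV R d -> 'I_m) (cen : 'I_m -> V),
    [/\ forall i, measurable (pi @^-1` [set i]), forall i, Z (cen i)
      & forall x, Z x -> `|x - cen (pi x)| < e].
Proof.
move=> [z0 Zz0] Zb e0.
have e2 : 0 < e / 2 by rewrite divr_gt0.
have [s net] := bounded_finite_net Zb e2.
pose inb (x : borel_rV R d) := fun c : V => `|c - x| < e / 2.
(* The last index, [size s], collects the points that lie in no ball of the net. *)
have lt_find x : (find (inb x) s < (size s).+1)%N by rewrite ltnS find_size.
pose pi (x : borel_rV R d) := Ordinal (lt_find x).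
pose cell i := Z `&` pi @^-1` [set i].
(* Centres are chosen in [Z], where the bounds on the class hold, and not among the net points; this
   costs a factor 2 in distance, whence the radius [e / 2]. An empty cell gets the default [z0]. *)
pose cen i := if pselect (cell i !=set0) is left ne then sval (cid ne) else z0.
have mb c : measurable [set x : borel_rV R d | inb x c].
  apply: sub_sigma_algebra; rewrite (_ : mkset _ = ball c (e / 2)).
    exact: ball_open.
  by rewrite -ball_normE.
(* By induction on the net: the first index exceeds [k] when the first ball misses [x] and the index
   in the rest of the list is at least [k]. Each cell is a difference of two consecutive such
   sets. *)
have mge k : measurable [set x : borel_rV R d | (k <= find (inb x) s)%N].
  elim: s {net lt_find pi cell cen} k => [|c s IH] [|k].
  - by rewrite (_ : mkset _ = setT)//; apply/seteqP; split.
  - by rewrite (_ : mkset _ = set0)//; apply/seteqP; split.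
  - by rewrite (_ : mkset _ = setT)//; apply/seteqP; split.
  - rewrite (_ : mkset _ = ~` [set x | inb x c] `&`
        [set x | (k <= find (inb x) s)%N]).
      by apply: measurableI; [exact: measurableC|exact: IH].
    by apply/seteqP; split => x /=; case: (inb x c) => // -[].
exists (size s).+1, pi, cen; split.
- move=> i; rewrite (_ : _ @^-1` _ = [set x | (i <= find (inb x) s)%N] `\`
      [set x | (i < find (inb x) s)%N]); first exact: measurableD.
  apply/seteqP; split => x /=.
    by move=> <-/=; rewrite leqnn ltnn; split.
  move=> [ix /negP]; rewrite -leqNgt => xi; apply/val_inj/eqP => /=.
  by rewrite eqn_leq xi ix.
- move=> i; rewrite /cen; case: pselect => // ne.
  exact: (proj1 (svalP (cid ne))).
- move=> x Zx; rewrite /cen; case: pselect => [ne|]; last by case; exists x.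
  case: cid => y /= [Zy /(congr1 val)/= yx].
  have [c cs cx] := net _ Zx.
  have hx : has (inb x) s by apply/hasP; exists c.
  have hy : has (inb y) s by rewrite has_find yx -has_find.
  have := nth_find z0 hx; have := nth_find z0 hy.
  (* [x] and the chosen [y] have the same first ball, and the triangle inequality goes through its
     centre [b]. *)
  rewrite yx /inb; set b := nth _ _ _ => yb xb.
  rewrite -(subrKA b) [e]splitr; apply: le_lt_trans (ler_normD _ _) _.
  by rewrite ltrD// distrC.
Qed.

End totally_bounded.

Section finite_valued.
Context d (T : measurableType d) (R : realType) (mu : probability T R).
Variables (K : finType) (pi : T -> K).
Hypothesis mpi : forall k, measurable (pi @^-1` [set k]).

Let finite_valuedE (F : K -> R) x : (F (pi x))%:E =
  (\sum_(k <- enum K) (F k)%:E * (\1_(pi @^-1` [set k]) x)%:E)%E.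
Proof.
rewrite big_enum/= (bigD1 (pi x))//= indicE mem_set//.
rewrite mule1 big1 ?adde0// => k /eqP kx; rewrite indicE memNset ?mule0//=.
by move=> /esym.
Qed.

Lemma integrable_finite_valued (F : K -> R) :
  mu.-integrable setT (EFin \o (F \o pi)).
Proof.
have -> : EFin \o (F \o pi) =
    (fun x => \sum_(k <- enum K) (F k)%:E * (\1_(pi @^-1` [set k]) x)%:E)%E.
  by apply/funext => x; exact: finite_valuedE.
apply: integrable_sum => // k _; apply: integrableZl => //.
exact: integrable_indic.
Qed.

Lemma integral_finite_valued (F : K -> R) (D : set T) : measurable D ->
  \int[mu]_(x in D) F (pi x) =
  \sum_k fine (mu (pi @^-1` [set k] `&` D)) * F k.
Proof.
move=> mD; rewrite /Rintegral.
under eq_integral do rewrite finite_valuedE.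
have i1 k : mu.-integrable D (fun x => (\1_(pi @^-1` [set k]) x)%:E).
  by apply: integrableS (integrable_indic mu (mpi k)).
rewrite integral_sum//; last by move=> k; exact: integrableZl.
rewrite big_enum/= -[RHS]/(fine (EFin _)); congr fine.
rewrite -sumEFin; apply: eq_bigr => k _; rewrite integralZl//.
rewrite integral_indic// EFinM fineK 1?muleC// fin_num_measure//.
exact: measurableI.
Qed.

End finite_valued.

Lemma probability_setI_full d (T : measurableType d) (R : realType)
    (mu : probability T R) (A D : set T) :
  measurable A -> measurable D -> mu D = 1%E -> mu (A `&` D) = mu A.
Proof.
move=> mA mD D1; rewrite [RHS](measureDI mu mA mD) setDE.
rewrite [X in (X + _)%E](_ : _ = 0%E) ?add0e//.
apply/eqP; rewrite eq_le measure_ge0 andbT.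
have <- : mu (~` D) = 0%E by rewrite probability_setC// D1 subee.
have mDC := measurableC mD.
by apply: le_measure; rewrite ?inE//; exact: measurableI.
Qed.

(* [g] need not be measurable: the integral of a nonnegative function is the
   supremum of the integrals of the simple functions below it. *)
Lemma le_Rintegral_lower d (T : measurableType d) (R : realType)
    (mu : {measure set T -> \bar R}) (D : set T) (f g : T -> R) (M : R) :
  measurable D -> (mu D < +oo)%E ->
  (forall x, D x -> 0 <= f x) -> (forall x, D x -> f x <= g x) ->
  (forall x, D x -> g x <= M) ->
  \int[mu]_(x in D) f x <= \int[mu]_(x in D) g x.
Proof.
move=> mD Dfin f0 fg gM.
have g0 x : D x -> 0 <= g x by move=> Dx; exact: le_trans (f0 _ Dx) (fg _ Dx).
have fgi : (\int[mu]_(x in D) (f x)%:E <= \int[mu]_(x in D) (g x)%:E)%E.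
  by apply: ge0_le_lower_integral => x Dx; rewrite lee_fin;
    [exact: f0|exact: fg].
have gfin : (\int[mu]_(x in D) (g x)%:E < +oo)%E.
  apply: (@le_lt_trans _ _ (\int[mu]_(x in D) (M%:E))%E).
    by apply: ge0_le_lower_integral => x Dx; rewrite lee_fin;
      [exact: g0|exact: gM].
  have Df : mu D \is a fin_num by rewrite ge0_fin_numE.
  by rewrite integral_cst// -(fineK Df) -EFinM ltry.
have gge0 : (0 <= \int[mu]_(x in D) (g x)%:E)%E.
  by apply: integral_ge0 => x Dx; rewrite lee_fin g0.
have fge0 : (0 <= \int[mu]_(x in D) (f x)%:E)%E.
  by apply: integral_ge0 => x Dx; rewrite lee_fin f0.
rewrite /Rintegral; apply: fine_le => //; rewrite ge0_fin_numE//.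
exact: le_lt_trans fgi _.
Qed.

(** Open rays generate the Borel sets of the line, and their preimages within [Z] are open. *)
Lemma open_continuous_borel_measurable (R : realType) (d : nat)
    (Z : set 'rV[R]_d) (h : 'rV[R]_d -> R) :
  open Z -> (forall x, Z x -> {for x, continuous h}) ->
  measurable_fun (Z : set (borel_rV R d)) h.
Proof.
move=> oZ ch; apply: (measurability _ (RGenOInfty.measurableE R)).
move=> _ [_ [a ->] <-]; apply: sub_sigma_algebra.
rewrite openE => x [Zx /=]; rewrite in_itv/= andbT => ax.
apply: filterI; first exact: open_nbhs_nbhs.
apply: (ch x Zx); apply: open_nbhs_nbhs; split; first exact: interval_open.
by rewrite /= in_itv/= andbT.
Qed.

(** Integration against a sum of Dirac masses is available for nonnegative functions, so [h] is
    split into its positive and negative parts. *)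
Lemma empirical_risk (R : realType) (d n : nat) (Z : set (borel_rV R d))
    (x : nat -> borel_rV R d) (h : borel_rV R d -> R) :
  measurable Z ->
  measurable_fun Z h -> (forall i, Z (x i)) ->
  risk Z (empirical n x) h = n%:R^-1 * \sum_(i < n) h (x i).
Proof.
move=> mZ mh Zx; rewrite /risk /Rintegral.
have mf : measurable_fun Z (fun y => (h y)%:E).
  exact/measurable_EFinP.
have ge0int (f : borel_rV R d -> R) :
    measurable_fun Z (fun y => (f y)%:E) -> (forall y, 0 <= f y) ->
    (\int[empirical n x]_(y in Z) (f y)%:E =
     (n%:R^-1 * \sum_(i < n) f (x i))%:E)%E.
  move=> mff f0.
  have f0' y : Z y -> (0 <= (f y)%:E)%E by rewrite lee_fin.
  rewrite ge0_integral_mscale//.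
  rewrite ge0_integral_measure_sum// EFinM; congr (_ * _)%E.
  rewrite -sumEFin; apply: eq_bigr => i _.
  by rewrite integral_dirac// diracE mem_set// mul1e.
have posE : (fun y => (h y)%:E)^\+%E = (fun y => (Num.max (h y) 0)%:E).
  by apply/funext => y; rewrite funeposE EFin_max.
have negE : (fun y => (h y)%:E)^\-%E = (fun y => (Num.max (- h y) 0)%:E).
  by apply/funext => y; rewrite funenegE EFin_max.
rewrite integralE posE negE !ge0int//; last 4 first.
- by rewrite -negE; exact: measurable_funeneg.
- by move=> y; rewrite le_max lexx orbT.
- by rewrite -posE; exact: measurable_funepos.
- by move=> y; rewrite le_max lexx orbT.
rewrite -EFinB/= -mulrBr -sumrB; congr (_ * _); apply: eq_bigr => i _.
by have [h0|h0] := leP 0 (h (x i)); case: (leP (- h (x i)) 0); lra.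
Qed.

(** * Gradients of Lipschitz functions *)

Section norms.
Variables (R : realType) (d : nat) (N : 'rV[R]_d -> R).
Hypothesis Nnorm : is_norm N.

Let N_triangle x y : N (x + y) <= N x + N y. Proof. by case: Nnorm. Qed.

Let N_homog (a : R) x : N (a *: x) = `|a| * N x. Proof. by case: Nnorm. Qed.

Lemma is_norm_zero : N 0 = 0.
Proof. by rewrite -(scale0r 0) N_homog normr0 mul0r. Qed.

Lemma is_norm_ge0 x : 0 <= N x.
Proof.
have : N (x - x) <= N x + N (- x) by exact: N_triangle.
rewrite subrr is_norm_zero -scaleN1r N_homog normrN1 mul1r; lra.
Qed.

(** Expand [x] in the canonical basis; [|x|] is the maximum norm. This transfers Lipschitz bounds in
    [N] to the metric in which the sample space is partitioned. *)
Lemma is_norm_bounded : exists2 C, 0 <= C & forall x, N x <= C * `|x|.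
Proof.
exists (\sum_(j < d) N (delta_mx ord0 j)).
  by apply: sumr_ge0 => j _; exact: is_norm_ge0.
move=> x; rewrite {1}(row_sum_delta x) mulr_suml.
have Nsum (s : seq 'I_d) (F : 'I_d -> 'rV[R]_d) :
    N (\sum_(j <- s) F j) <= \sum_(j <- s) N (F j).
  elim: s => [|j s IH]; first by rewrite !big_nil is_norm_zero.
  by rewrite !big_cons; apply: le_trans (N_triangle _ _) _; rewrite lerD2l.
apply: le_trans (Nsum _ _) _; apply: ler_sum => j _; rewrite N_homog mulrC.
apply: ler_wpM2l; first exact: is_norm_ge0.
rewrite [leRHS]/Num.Def.normr/= mx_normrE; apply/bigmax_geP; right.
by exists (ord0, j).
Qed.

(** [Lip] is an infimum; any strictly larger number dominates an actual Lipschitz constant. *)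
Lemma Lip_lt (D : set 'rV[R]_d) (h : 'rV[R]_d -> R) (L L' : R) :
  (Lip N D h <= L%:E)%E -> L < L' ->
  forall x y, D x -> D y -> `|h x - h y| <= L' * N (x - y).
Proof.
move=> hL LL' x y Dx Dy.
have : (Lip N D h < L'%:E)%E by apply: le_lt_trans hL _; rewrite lte_fin.
move=> /ereal_inf_lt[_ [l [l0 hl] <-]]; rewrite lte_fin => lL.
apply: le_trans (hl _ _ Dx Dy) _; apply: ler_wpM2r; last exact: ltW.
exact: is_norm_ge0.
Qed.

Section gradient.
Variables (Z : set 'rV[R]_d) (h : 'rV[R]_d -> R) (L : R) (x : 'rV[R]_d).
Hypotheses (oZ : open Z) (Zx : Z x) (dh : differentiable h x) (L0 : 0 <= L).
Hypothesis hL : forall x y, Z x -> Z y -> `|h x - h y| <= L * N (x - y).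

(** For small [t] the point [t *: v + x] stays in the open set [Z], so the difference quotients
    satisfy the bound. *)
Lemma derive_le_lipschitz v : 'D_v h x <= L * N v.
Proof.
apply: limr_le; first exact: diff_derivable.
have near_Z : \forall t \near (0 : R), Z (t *: v + x).
  have cv : {for (0 : R), continuous (fun t : R => t *: v + x)}.
    apply: continuousD; last exact: cst_continuous.
    exact: scalel_continuous.
  apply: cv; rewrite scale0r add0r; exact: open_nbhs_nbhs.
near=> t.
have t0 : t != 0 by near: t; exact: nbhs_dnbhs_neq.
have Zt : Z (t *: v + x) by near: t; exact: nbhs_dnbhs.
apply: le_trans (ler_norm _) _; rewrite /= normrZ normfV.
rewrite ler_pdivrMl ?normr_gt0// mulrCA -N_homog.
by apply: le_trans (hL Zt Zx) _; rewrite addrK.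
Unshelve. all: by end_near. Qed.

Let dual_set :=
  [set \sum_(i < d) grad h x ord0 i * v ord0 i | v in [set v | N v <= 1]].

Let dual_set0 : dual_set 0.
Proof.
exists 0; first by rewrite /= is_norm_zero ler01.
by apply: big1 => i _; rewrite [X in _ * X]mxE mulr0.
Qed.

(** By linearity of the differential, pairing the gradient with [v] gives the directional derivative
    along [v]. *)
Let dual_set_le : ubound dual_set L.
Proof.
move=> _ [v /= Nv1 <-].
have -> : \sum_(i < d) grad h x ord0 i * v ord0 i = 'D_v h x.
  rewrite deriveE// {2}(row_sum_delta v) linear_sum/=; apply: eq_bigr => i _.
  by rewrite linearZ/= -deriveE// mxE mulrC.
by apply: le_trans (derive_le_lipschitz v) _; rewrite ler_piMr.
Qed.

Lemma dual_norm_grad_ge0 : 0 <= dual_norm N (grad h x).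
Proof. by apply: ub_le_sup; [exists L|exact: dual_set0]. Qed.

Lemma dual_norm_grad_le : dual_norm N (grad h x) <= L.
Proof. by apply: ge_sup; [exists 0|exact: dual_set_le]. Qed.

End gradient.

(** The dual norm of the gradient is at most [L] at every point of [Z], a set of mass 1, so the
    power mean is at most [L] as well. *)
Lemma Lr_norm_grad_le (Z : set 'rV[R]_d) (h : 'rV[R]_d -> R) (L r : R)
    (Q : {measure set (borel_rV R d) -> \bar R}) :
  open Z -> (forall x, Z x -> differentiable h x) -> 0 <= L -> 0 < r ->
  (forall x y, Z x -> Z y -> `|h x - h y| <= L * N (x - y)) ->
  Q Z = 1%E -> Lr_norm N Z Q r (grad h) <= L.
Proof.
move=> oZ dh L0 r0 hL QZ.
have mZ : measurable (Z : set (borel_rV R d)) by exact: sub_sigma_algebra.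
have gL x : Z x -> dual_norm N (grad h x) `^ r <= L `^ r.
  move=> Zx; apply: ge0_ler_powR; rewrite ?nnegrE ?(ltW r0)//.
    by apply: (@dual_norm_grad_ge0 Z _ L) => //; exact: dh.
  by apply: (@dual_norm_grad_le Z _ L) => //; exact: dh.
have IL : \int[Q]_(x in Z) (dual_norm N (grad h x) `^ r) <= L `^ r.
  apply: (@le_trans _ _ (\int[Q]_(x in Z) (L `^ r))).
    apply: (@le_Rintegral_lower _ _ _ _ _ _ _ (L `^ r)) => //.
      by rewrite QZ ltey.
    by move=> *; exact: powR_ge0.
  by rewrite Rintegral_cst// QZ /= mulr1.
rewrite /Lr_norm; apply: (@le_trans _ _ ((L `^ r) `^ r^-1)).
  apply: ge0_ler_powR; rewrite ?nnegrE ?invr_ge0 ?(ltW r0) ?powR_ge0//.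
  by apply: Rintegral_ge0 => x _; exact: powR_ge0.
by rewrite -powRrM mulfV ?gt_eqF// powRr1.
Qed.

End norms.

(** * Uniform deviations *)

Section uniform_deviation.
Context (R : realType) (d : nat) (dO : measure_display)
  (Omega : measurableType dO).
Variables (P : probability Omega R) (Pdata : probability (borel_rV R d) R).
Variable z : nat -> {mfun Omega >-> borel_rV R d}.
Hypothesis iid_z : iid P Pdata z.

Section finite_law.
Variables (m n : nat) (pi : borel_rV R d -> 'I_m).
Hypothesis mpi : forall k, measurable (pi @^-1` [set k]).

Let smp w : {ffun 'I_n -> 'I_m} := [ffun i : 'I_n => pi (z i w)].

(** Independence is stated for events indexed by [nat]; indices beyond the sample get the whole
    space. *)
Let fibre (c : {ffun 'I_n -> 'I_m}) (j : nat) : set (borel_rV R d) :=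
  if insub j is Some i then pi @^-1` [set c i] else setT.

Let mfibre c j : measurable (fibre c j).
Proof. by rewrite /fibre; case: insub. Qed.

Let smp_preimage c : smp @^-1` [set c] =
  \bigcap_(j in [set` iota 0 n]) (z j @^-1` fibre c j).
Proof.
apply/seteqP; split => w /=.
  move=> <- j /=; rewrite /fibre; case: insubP => // i _ <- _ /=.
  by rewrite ffunE.
move=> Hw; apply/ffunP => i; rewrite ffunE.
have /= := Hw i; rewrite mem_iota/= add0n ltn_ord => /(_ isT).
by rewrite /fibre valK.
Qed.

Lemma measurable_sample_preimage c : measurable (smp @^-1` [set c]).
Proof.
rewrite smp_preimage; apply: fin_bigcap_measurable; first exact: finite_seq.
by move=> j _; rewrite -[X in measurable X]setTI; exact: measurable_funP.
Qed.

(** By independence and equality in law, the discretized sample has exactly the product law used in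
    the finite symmetrization. *)
Lemma sample_law c : P (smp @^-1` [set c]) =
  (\prod_i fine (Pdata (pi @^-1` [set c i])))%:E.
Proof.
have [ind same] := iid_z.
rewrite smp_preimage (ind _ _ (iota_uniq 0 n) (mfibre c)).
rewrite -prodEFin -[in LHS](subn0 n) big_mkord; apply: eq_bigr => i _.
rewrite -[LHS]/(distribution P (z i) (fibre c i)) (same _ _ (mfibre c i)).
by rewrite /fibre valK fineK// fin_num_measure.
Qed.

End finite_law.

Variables (Z : set (borel_rV R d)) (H : set (borel_rV R d -> R)) (M C : R).
Hypotheses (mZ : measurable Z) (Zb : bounded_set (Z : set 'rV[R]_d)).
Hypotheses (Z1 : Pdata Z = 1%E) (Zz : forall i w, Z (z i w)).
Hypotheses (H0 : H !=set0) (mH : forall h, H h -> measurable_fun Z h).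
Hypothesis HM : forall h, H h -> forall x, Z x -> `|h x| <= M.
Hypothesis C0 : 0 <= C.
Hypothesis HC : forall h, H h -> forall x y : 'rV[R]_d, Z x -> Z y ->
  `|h x - h y| <= C * `|x - y|.

(** The finite sum is the integral of [F \o pi] over [Z], which has full mass, so the pointwise
    bound integrates. *)
Lemma finite_valued_risk (m : nat) (pi : borel_rV R d -> 'I_m)
    (h : borel_rV R d -> R) (F : 'I_m -> R) (e : R) :
  (forall k, measurable (pi @^-1` [set k])) -> H h ->
  (forall x, Z x -> `|h x - F (pi x)| <= e) ->
  `|risk Z Pdata h - \sum_k fine (Pdata (pi @^-1` [set k])) * F k| <= e.
Proof.
move=> mpi Hh he.
have -> : \sum_k fine (Pdata (pi @^-1` [set k])) * F k =
    \int[Pdata]_(x in Z) F (pi x).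
  rewrite integral_finite_valued//; apply: eq_bigr => k _.
  by rewrite (probability_setI_full (mpi k) mZ Z1).
have Zfin : (Pdata Z < +oo)%E by rewrite Z1 ltry.
have ih : Pdata.-integrable Z (EFin \o h).
  apply: measurable_bounded_integrable => //; first exact: mH.
  exists M; split; first exact: num_real.
  by move=> r /ltW Mr x Zx; apply: le_trans Mr; exact: HM.
have iF : Pdata.-integrable Z (EFin \o (F \o pi)).
  by apply: integrableS (integrable_finite_valued Pdata mpi F).
rewrite /risk -RintegralB//.
apply: le_trans (le_normr_Rintegral _ _) _ => //.
  by have := integrableB mZ ih iF.
have -> : e = \int[Pdata]_(x in Z) e.
  transitivity (e * fine (Pdata Z)); first by rewrite Z1 mulr1.
  by rewrite Rintegral_cst.
by apply: (@le_Rintegral_lower _ _ _ _ _ _ _ e).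
Qed.

(* Discretizing the sample space at a scale where the class varies by at most
   [e] reduces the deviation to a function of finite-valued random variables,
   which disposes of the measurability of suprema over [H]. *)
Lemma uniform_deviation (n : nat) (e t : R) : (0 < n)%N -> 0 < e -> 0 < t ->
  exists A : set Omega, [/\ measurable A,
    fine (P A) <= 2 * (rademacher P z H n + e) / t
    & forall w, ~ A w -> forall h, H h ->
      `|n%:R^-1 * (\sum_(i < n) h (z i w)) - risk Z Pdata h| <= t + 2 * e].
Proof.
move=> n0 e0 t0; have [h0 Hh0] := H0.
have Z0 : Z !=set0.
  apply/set0P/negP => /eqP Z0; move: Z1; rewrite Z0 measure0 => /eqP.
  by rewrite eq_sym onee_eq0.
(* Cells of mesh [e / (C + 1)] make every function of the class vary by at most [e]; adding 1 keeps
   the divisor positive. *)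
have C1 : 0 < C + 1 by rewrite ltr_wpDl.
have [m [pi [cen [mpi Zcen cen_near]]]] :=
  bounded_finite_partition Z0 Zb (divr_gt0 e0 C1).
have hcen h x : H h -> Z x -> `|h x - h (cen (pi x))| <= e.
  move=> Hh Zx; apply: le_trans (HC Hh Zx (Zcen _)) _.
  apply: (@le_trans _ _ (C * (e / (C + 1)))).
    by rewrite ler_wpM2l// ltW// cen_near.
  rewrite mulrCA ger_pMr// ler_pdivrMr// mul1r; lra.
pose q k := fine (Pdata (pi @^-1` [set k])).
have q0 k : 0 <= q k by exact/fine_ge0/measure_ge0.
have q1 : \sum_k q k = 1.
  transitivity (\int[Pdata]_(x in setT) (1 : R)).
    rewrite (integral_finite_valued Pdata mpi (fun=> 1) measurableT).
    by apply: eq_bigr => k _; rewrite setIT mulr1.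
  rewrite Rintegral_cst// mul1r.
  exact: (congr1 fine (probability_setT Pdata)).
pose wt (c : {ffun 'I_n -> 'I_m}) := \prod_i q (c i).
pose smp w : {ffun 'I_n -> 'I_m} := [ffun i : 'I_n => pi (z i w)].
have msmp := @measurable_sample_preimage m n pi mpi.
have int_smp (F : {ffun 'I_n -> 'I_m} -> R) :
    \int[P]_w F (smp w) = \sum_c wt c * F c.
  rewrite (integral_finite_valued P msmp F measurableT).
  by apply: eq_bigr => c _; rewrite setIT sample_law.
have wt0 (c : {ffun 'I_n -> 'I_m}) : 0 <= wt c by exact: prodr_ge0.
pose mean h := \sum_k q k * h (cen k).
pose dev (c : {ffun 'I_n -> 'I_m}) :=
  sup_abs H (fun h => \sum_(i < n) (h (cen (c i)) - mean h)).
pose rad (c : {ffun 'I_n -> 'I_m}) := (2 ^+ n)^-1 *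
  \sum_(s : {ffun 'I_n -> bool})
     sup_abs H (fun h => \sum_i (-1) ^+ s i * h (cen (c i))).
have nR : 0 < n%:R :> R by rewrite ltr0n.
have symm : \sum_c wt c * (n%:R^-1 * dev c) <=
    2 * \sum_c wt c * (n%:R^-1 * rad c).
  under eq_bigr do rewrite mulrCA.
  under [X in _ <= 2 * X]eq_bigr do rewrite mulrCA.
  rewrite -!mulr_sumr [leRHS]mulrCA ler_wpM2l ?invr_ge0 ?(ltW nR)//.
  apply: (finite_symmetrization _ q0 q1 (F := fun h k => h (cen k))
    (M := M)) => //.
  by move=> h Hh k; exact: HM.
have sum_le (F : 'I_n -> R) (B : R) : (forall i, `|F i| <= B) ->
    `|\sum_i F i| <= n%:R * B.
  move=> FB; apply: le_trans (ler_norm_sum _ _ _) _.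
  rewrite mulr_natl -[X in _ *+ X]card_ord -sumr_const; exact: ler_sum.
(* The integrand of [rademacher], evaluated on the true sample, whereas [rad] is evaluated on the
   cell centres. *)
pose radw w := (2 ^+ n)^-1 * \sum_(s : {ffun 'I_n -> bool})
  (n%:R^-1 * sup_abs H (fun h => \sum_(i < n) (-1) ^+ s i * h (z i w))).
have sgn (s : {ffun 'I_n -> bool}) i (x : R) : `|(-1) ^+ s i * x| = `|x|.
  by rewrite normrM normrX normrN1 expr1n mul1r.
have signed_bound (s : {ffun 'I_n -> bool}) w h : H h ->
    `|\sum_(i < n) (-1) ^+ s i * h (z i w)| <= n%:R * M.
  by move=> Hh; apply: sum_le => i; rewrite sgn; exact: HM.
have average (F : {ffun 'I_n -> bool} -> R) (B : R) : (forall s, F s <= B) ->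
    (2 ^+ n)^-1 * \sum_s F s <= B.
  move=> FB; rewrite ler_pdivrMl ?exprn_gt0//.
  apply: le_trans (ler_sum _ (fun s _ => FB s)) _.
  by rewrite sumr_const card_ffun card_bool card_ord -natrX mulr_natl.
have radwM w : radw w <= M.
  apply: average => s; rewrite ler_pdivrMl//; apply: sup_abs_le => // h.
  exact: signed_bound.
have radw_ge0 w : 0 <= radw w.
  apply: mulr_ge0; first by rewrite invr_ge0 exprn_ge0.
  apply: sumr_ge0 => s _; rewrite mulr_ge0 ?invr_ge0 ?(ltW nR)//.
  exact: sup_abs_ge0.
have rad_le w : n%:R^-1 * rad (smp w) - e <= radw w.
  rewrite lerBlDr -lerBlDl /rad /radw mulrCA -mulrBr mulr_sumr -sumrB.
  apply: average => s; rewrite -mulrBr ler_pdivrMl// lerBlDr.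
  apply: sup_abs_le => // h Hh; rewrite addrC.
  have -> : \sum_i (-1) ^+ s i * h (cen (smp w i)) =
      \sum_(i < n) (-1) ^+ s i * h (z i w) +
      \sum_(i < n) (-1) ^+ s i * (h (cen (smp w i)) - h (z i w)).
    by rewrite -big_split; apply: eq_bigr => i _ /=;
      rewrite -mulrDr addrC subrK.
  apply: le_trans (ler_normD _ _) _; apply: lerD.
    by apply: sup_abs_ub Hh => g Hg; exact: signed_bound.
  by apply: sum_le => i; rewrite sgn distrC ffunE; exact: hcen.
have rad_int : \sum_c wt c * (n%:R^-1 * rad c) <=
    rademacher P z H n + e.
  rewrite -lerBlDr.
  have <- : \sum_c wt c * (n%:R^-1 * rad c - e) =
      \sum_c wt c * (n%:R^-1 * rad c) - e.
    under eq_bigr do rewrite mulrBr.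
    rewrite sumrB -mulr_suml; congr (_ - _).
    by rewrite -(bigA_distr_bigA (fun=> q)) big1// mul1r.
  (* Truncation at 0 gives a nonnegative function of the discretized sample that still lies below
     [radw], as the comparison of lower integrals requires. *)
  apply: (@le_trans _ _ (\sum_c wt c *
      Num.max 0 (n%:R^-1 * rad c - e))).
    by apply: ler_sum => c _; rewrite ler_wpM2l// le_max lexx orbT.
  rewrite -int_smp -[rademacher P z H n]/(\int[P]_w radw w).
  apply: (@le_Rintegral_lower _ _ _ _ _ _ _ M) => //.
  - by rewrite /= probability_setT ltry.
  - by move=> w _; rewrite le_max lexx.
  - by move=> w _; rewrite ge_max radw_ge0 rad_le.
(* The bad event depends on the discretized sample only, so it is a finite union of measurable
   fibres. *)
pose A := [set w | t < n%:R^-1 * dev (smp w)].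
have AE : A = \bigcup_(c in [set c | t < n%:R^-1 * dev c]) (smp @^-1` [set c]).
  apply/seteqP; split => w /=; first by move=> Aw; exists (smp w).
  by case=> c tc wc; rewrite /A/= (wc : smp w = c).
have mA : measurable A.
  by rewrite AE; apply: fin_bigcup_measurable; first exact: finite_finset.
exists A; split => //.
- have -> : fine (P A) = \int[P]_w ((t < n%:R^-1 * dev (smp w))%R)%:R.
    rewrite /Rintegral -[in LHS](setIT A) -integral_indic//.
    congr fine; apply: eq_integral => w _; rewrite indicE.
    suff -> : (w \in A) = (t < n%:R^-1 * dev (smp w)) by [].
    by apply/idP/idP; rewrite inE.
  rewrite (int_smp (fun c => ((t < n%:R^-1 * dev c)%R)%:R)).
  rewrite ler_pdivlMr// mulr_suml.
  (* Markov's inequality: [t] times the indicator of the bad event is at most the deviation. *)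
  apply: (@le_trans _ _ (\sum_c wt c * (n%:R^-1 * dev c))).
    apply: ler_sum => c _; rewrite -mulrA ler_wpM2l//.
    case: ltP => [/ltW|_]; rewrite ?mul1r// mul0r.
    by rewrite mulr_ge0 ?invr_ge0 ?(ltW nR)//; exact: sup_abs_ge0.
  by apply: le_trans symm _; rewrite ler_wpM2l.
(* Off [A] the deviation has three parts: sample against centres ([e]), centres against the
   discretized mean ([t]), and that mean against the risk ([e]). *)
- move=> w /negP; rewrite -leNgt => dw h Hh.
  have r_close : `|risk Z Pdata h - mean h| <= e.
    apply: (@finite_valued_risk m pi h (fun k => h (cen k))) => // x Zx.
    exact: hcen.
  have d_close : `|n%:R^-1 * \sum_(i < n) (h (cen (pi (z i w))) - mean h)| <= t.
    rewrite normrM ger0_norm ?invr_ge0 ?(ltW nR)//; apply: le_trans dw.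
    rewrite ler_wpM2l ?invr_ge0 ?(ltW nR)//.
    have -> : \sum_(i < n) (h (cen (pi (z i w))) - mean h) =
      \sum_(i < n) (h (cen (smp w i)) - mean h).
      by apply: eq_bigr => i _; rewrite ffunE.
    apply: (sup_abs_ub (M := n%:R * (M + M))) Hh => g Hg.
    apply: sum_le => i; apply: le_trans (ler_normB _ _) _; apply: lerD.
      exact: HM.
    rewrite -[leRHS]mul1r -q1 mulr_suml; apply: le_trans (ler_norm_sum _ _ _) _.
    by apply: ler_sum => k _; rewrite normrM ger0_norm// ler_wpM2l//; exact: HM.
  have z_close :
      `|n%:R^-1 * \sum_(i < n) (h (z i w) - h (cen (pi (z i w))))| <= e.
    rewrite normrM ger0_norm ?invr_ge0 ?(ltW nR)// ler_pdivrMl//.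
    by apply: sum_le => i; exact: hcen.
  have -> : n%:R^-1 * (\sum_(i < n) h (z i w)) - risk Z Pdata h =
      n%:R^-1 * (\sum_(i < n) (h (z i w) - h (cen (pi (z i w))))) +
      n%:R^-1 * (\sum_(i < n) (h (cen (pi (z i w))) - mean h)) -
      (risk Z Pdata h - mean h).
    rewrite -mulrDr -big_split/=.
    under [in RHS]eq_bigr do rewrite addrA subrK.
    rewrite sumrB sumr_const card_ord mulrBr -[mean h *+ n]mulr_natl.
    rewrite mulKf ?gt_eqF//.
    lra.
  move: r_close d_close z_close; rewrite !ler_norml.
  move=> /andP[? ?] /andP[? ?] /andP[? ?]; apply/andP; split; lra.
Qed.

End uniform_deviation.

(** * Excess risk of the penalized minimizer *)

Unset Implicit Arguments.

Theorem theorem3 (R : realType) (d : nat) (N : 'rV[R]_d -> R)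
  (Z : set 'rV[R]_d) (Pdata : probability (borel_rV R d) R)
  (dO : measure_display) (Omega : measurableType dO) (P : probability Omega R)
  (z : nat -> {mfun Omega >-> borel_rV R d})
  (alpha : nat -> R) (CH Cnabla L k p : R) (H : set ('rV[R]_d -> R))
  (hhat : nat -> Omega -> 'rV[R]_d -> R) :
  is_norm N ->
  open Z -> bounded_set Z ->
  Pdata Z = 1%E ->
  iid P Pdata z -> (forall i w, Z (z i w)) ->
  (forall n, (0 < n)%N -> 0 < alpha n) -> alpha @ \oo --> (0 : R) ->
  0 < CH -> 0 < Cnabla -> 0 < L -> 0 < k -> k <= 1 ->
  uniformly_bounded (Conv Z) H ->
  (forall h, H h -> forall x, Conv Z x -> differentiable h x) ->
  (forall h, H h -> hoelder_continuous N (Conv Z) CH k (grad h)) ->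
  (forall h, H h ->
    (Cnabla%:E <= \int[Pdata]_(x in Z) (dual_norm N (grad h x))%:E)%E) ->
  (forall h, H h -> (Lip N (Conv Z) h <= L%:E)%E) ->
  1 + k < p ->
  (forall n w, (0 < n)%N ->
    is_minimizer H
      (prop_risk N Z (empirical n (fun i => z i w)) (alpha n) p) (hhat n w)) ->
  big_Op P (fun n w => excess_risk Z Pdata H (hhat n w))
    (fun n => Num.max (rademacher P z H n)
       (Num.max (n%:R `^ (- 2^-1))
          (Num.max (alpha n) (ln n%:R * alpha n `^ (1 + k))))).
Proof.
move=> Nnorm oZ Zb Z1 iidz Zz alpha0 _ _ _ L0 k0 _ [M HM] dH _ _ HLip pk hmin.
have p1 : 1 < p by apply: lt_trans pk; rewrite ltrDl.
have ZConv : Z `<=` Conv Z by exact: sub_gen_smallest.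
have mZ : measurable (Z : set (borel_rV R d)) by exact: sub_sigma_algebra.
have [C0 C00 NC] := is_norm_bounded Nnorm.
have L1 : 0 <= L + 1 by rewrite addr_ge0 ?ltW.
have lip h : H h -> forall x y, Z x -> Z y ->
    `|h x - h y| <= (L + 1) * N (x - y).
  move=> Hh x y Zx Zy; apply: (Lip_lt Nnorm (HLip h Hh)).
  - by rewrite ltrDl.
  - exact: ZConv.
  - exact: ZConv.
have dZ h : H h -> forall x, Z x -> differentiable h x.
  by move=> Hh x Zx; apply: (dH h Hh); exact: ZConv.
have mH h : H h ->
    measurable_fun (Z : set (borel_rV R d)) (h : borel_rV R d -> R).
  move=> Hh; apply: open_continuous_borel_measurable => // x Zx.
  exact/differentiable_continuous/dZ.
have HZM h : H h -> forall x, Z x -> `|h x| <= M.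
  by move=> Hh x Zx; apply: (HM h Hh); exact: ZConv.
have lipC h : H h -> forall x y : 'rV[R]_d, Z x -> Z y ->
    `|h x - h y| <= ((L + 1) * C0) * `|x - y|.
  move=> Hh x y Zx Zy; apply: le_trans (lip h Hh x y Zx Zy) _.
  by rewrite -mulrA ler_wpM2l.
(* A probability space has a point, and the minimizer for [n = 1] at that point belongs to [H]. *)
have H0 : H !=set0.
  have [w _] : [set: Omega] !=set0.
    apply/set0P/negP => /eqP O0; have := probability_setT P.
    by rewrite O0 measure0 => /eqP; rewrite eq_sym onee_eq0.
  by have [Hh _] := hmin 1%N w isT; exists (hhat 1%N w).
move=> eps eps0.
(* The deviation level is [t * a]. As [rademacher] and [e] are at most [a], the failure probability
   is at most [4 / t], that is [4 * eps / 5]. *)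
pose t := 5 / eps; have t0 : 0 < t by rewrite divr_gt0.
(* Two deviations of size [t * a + 2 * e], with [e <= a], and a penalty of at most [(L + 1) * a]. *)
exists (2 * t + 4 + (L + 1)), 1%N => n n0.
set a := Num.max _ _.
(* The discretization error is set to the [n^(-1/2)] term already present in the rate. *)
pose e : R := n%:R `^ (- 2^-1).
have e0 : 0 < e by apply: powR_gt0; rewrite ltr0n.
have ea : e <= a by rewrite /a !le_max lexx orbT.
have alphaa : alpha n <= a by rewrite /a !le_max lexx !orbT.
have rada : rademacher P z H n <= a by rewrite /a le_max lexx.
have a0 : 0 < a by exact: lt_le_trans ea.
have [A [mA PA Adev]] := uniform_deviation iidz mZ Zb Z1 Zz H0 mH HZM
  (mulr_ge0 L1 C00) lipC n0 e0 (mulr_gt0 t0 a0).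
exists A; split => //; last first.
  have PAfin : P A \is a fin_num by rewrite fin_num_measure.
  rewrite -(fineK PAfin) lte_fin; apply: le_lt_trans PA _.
  rewrite ltr_pdivrMr; last exact: mulr_gt0.
  rewrite mulrA (_ : eps * t = 5); last first.
    by rewrite /t mulrC divfK// gt_eqF.
  lra.
move=> w /= Bw; apply: contrapT => nAw; move: Bw; apply/negP; rewrite -leNgt.
have {}Adev h (Hh : H h) := Adev w nAw h Hh.
have [Hhat hatmin] := hmin n w n0.
have nR : 0 < n%:R :> R by rewrite ltr0n.
set Q := empirical n (fun i => z i w) in hatmin.
have QE h : H h -> risk Z Q h = n%:R^-1 * \sum_(i < n) h (z i w).
  by move=> Hh; apply: empirical_risk => //; exact: mH.
have QZ : Q Z = 1%E.
  rewrite -[LHS]/((n%:R^-1)%:E *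
    \sum_(i < n) \d_(z i w) (Z : set (borel_rV R d)))%E.
  under eq_bigr do rewrite diracE mem_set//.
  by rewrite sumEFin sumr_const card_ord -EFinM mulVf// gt_eqF.
have q0 : 0 < (1 - p^-1)^-1.
  by rewrite invr_gt0 subr_gt0 invf_lt1// (lt_trans ltr01).
(* The penalty of the minimizer is dropped as nonnegative, and that of the competitor [h] is at most
   [alpha n * (L + 1)]. *)
have rel h : H h -> risk Z Q (hhat n w) <= risk Z Q h + alpha n * (L + 1).
  move=> Hh; apply: le_trans (_ : prop_risk N Z Q (alpha n) p (hhat n w) <= _).
    by rewrite lerDl mulr_ge0 ?powR_ge0// ltW// alpha0.
  apply: le_trans (hatmin h Hh) _; rewrite lerD2l.
  rewrite ler_wpM2l ?(ltW (alpha0 n n0))//.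
  by apply: Lr_norm_grad_le => //; [exact: dZ|exact: lip].
have alphaL : alpha n * (L + 1) <= (L + 1) * a by rewrite mulrC ler_wpM2l.
(* The risks are bounded below, so their infimum is a true lower bound and the excess risk is
   nonnegative. *)
have risk_lb h : H h -> - (M + (t * a + 2 * e)) <= risk Z Pdata h.
  move=> Hh; have := Adev h Hh; rewrite ler_norml => /andP[_].
  have : - M <= n%:R^-1 * \sum_(i < n) h (z i w).
    rewrite ler_pdivlMl// mulr_natl -[X in _ *+ X]card_ord.
    rewrite -sumr_const; apply: ler_sum => i _.
    by have := HZM h Hh _ (Zz i w); rewrite ler_norml => /andP[].
  move: (n%:R^-1 * _) (risk _ _ _) => x y; clear; lra.
rewrite /excess_risk ger0_norm; last first.
  rewrite subr_ge0; apply: ge_inf; last by exists (hhat n w).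
  by exists (- (M + (t * a + 2 * e))) => _ [h Hh <-]; exact: risk_lb.
(* It suffices to compare the minimizer with each competitor [h]: pass from risk to empirical risk,
   use minimality, and pass back. *)
rewrite lerBlDr -lerBlDl; apply: lb_le_inf.
  by case: H0 => h Hh; exists (risk Z Pdata h), h.
move=> _ [h Hh <-].
have := rel h Hh; have := Adev h Hh; have := Adev _ Hhat.
rewrite -!QE// !ler_norml => /andP[+ _] /andP[_].
move: (risk Z Q (hhat n w)) (risk Z Pdata (hhat n w)) => x1 x2.
move: (risk Z Q h) (risk Z Pdata h) (alpha n * (L + 1)) alphaL => x3 x4 x5.
by move: ea; clear; lra.
Qed.
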